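(* For each $n\ge 3$ and $q\ge 2$ there exists a tight irreducible subcube partition of $\{0,\dots,q-1\}^n$ of size $(n-1)q(q-1)+1$.
   Context: A subcube of $\{0,\dots,q-1\}^n$ is a set $\{x: x_{i_1}=b_1,\dots,x_{i_d}=b_d\}$, identified with a word in $\{0,\dots,q-1,*\}^n$. A subcube partition of $\{0,\dots,q-1\}^n$ is a partition into subcubes; its size is the number of subcubes. It is irreducible if there is no subset $G$ with $1<|G|<|F|$ whose union is a subcube, and tight if for every coordinate $i\in[n]$ some subcube $s$ has $s_i\ne *$. *)

(* Defs.v *)
From mathcomp Require Import all_boot.

Set Implicit Arguments.
Unset Strict Implicit.
Unset Printing Implicit Defensive.

Definition point (n q : nat) := {ffun 'I_n -> 'I_q}.

(* A word over {0, ..., q-1, *}: [Some b] is the symbol b, [None] is the star. *)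
Definition word (n q : nat) := {ffun 'I_n -> option 'I_q}.

Definition subcube (n q : nat) (w : word n q) : {set point n q} :=
  [set x : point n q | [forall i, (w i != None) ==> (w i == Some (x i))]].

(* For q >= 2 distinct words denote distinct subcubes, so a family of subcubes
   may be given by its set of words; this fails for q = 1. *)
Lemma subcube_inj (n q : nat) : 1 < q -> injective (@subcube n q).
Proof.
case: q => [|[|q]] // _ v w eq_vw.
pose dflt (u : word n q.+2) (b : 'I_q.+2) : point n q.+2 :=
  [ffun i => odflt b (u i)].
have in_dflt u b : dflt u b \in subcube u.
  by rewrite inE; apply/forallP=> i; rewrite ffunE; case: (u i) => /=.
have half (u u' : word n q.+2) i b : subcube u = subcube u' ->
    u i = Some b -> u' i = Some b \/ u' i = None.
  move=> eq_u ui; have := in_dflt u b; rewrite eq_u inE => /forallP/(_ i).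
  by rewrite ffunE ui /=; case: (u' i) => [c|] /=; [move/eqP; left | right].
have no_star (u u' : word n q.+2) i b : subcube u = subcube u' ->
    u i = Some b -> u' i <> None.
  move=> eq_u ui u'i.
  have bad c : c = b.
    have := in_dflt u' c; rewrite -eq_u inE => /forallP/(_ i).
    by rewrite ffunE ui u'i /= => /eqP[].
  by have := bad ord_max; rewrite -(bad ord0) => /(congr1 val).
apply/ffunP=> i; case Ev: (v i) => [b|]; case Ew: (w i) => [c|] //.
- by have [|] := half _ _ _ _ eq_vw Ev; rewrite Ew.
- by case: (no_star _ _ _ _ eq_vw Ev).
- by case: (no_star _ _ _ _ (esym eq_vw) Ew).
Qed.

Definition subcube_partition (n q : nat) (F : {set word n q}) : Prop :=
  partition [set subcube w | w in F] [set: point n q].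

Definition irreducible_family (n q : nat) (F : {set word n q}) : Prop :=
  ~ exists G : {set word n q},
      [/\ G \subset F, 1 < #|G| < #|F| &
          exists s : word n q, \bigcup_(w in G) subcube w = subcube s].

Definition tight (n q : nat) (F : {set word n q}) : Prop :=
  forall i : 'I_n, exists2 s, s \in F & s i != None.

(* Main.v *)
Require Import Defs.
From mathcomp Require Import all_boot.
From mathcomp Require Import zify.

(* Write a point as (a, c | y) with y of length n - 2. The points with a, c both
   nonzero are covered by the blocks whose head (a, c) is fixed and whose tail is
   all stars. The remaining heads form an L, the union of the lines a = 0 and
   c = 0, which splits in two ways into one full line and q - 1 single points.
   The splitting with full line a = 0 is used for y = 0, the one with full line
   c = 0 for each set of tails y with given first nonzero position and value.
   This gives (q-1)^2 + q (1 + (n-2)(q-1)) = (n-1) q (q-1) + 1 blocks.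
   If a subcube is a union of blocks, then every block that meets it lies inside
   it. The full line of one splitting of the L meets every piece of the other one
   but is contained in none, so that apart from single blocks only the whole cube
   has this property. *)

Set Implicit Arguments.
Unset Strict Implicit.
Unset Printing Implicit Defensive.

(** * Membership in subcubes, coordinate by coordinate *)

Section Agreement.
Variable q : nat.

Definition agrees (o : option 'I_q) (v : 'I_q) : bool :=
  (o != None) ==> (o == Some v).

Lemma agreesP o v : reflect (o = None \/ o = Some v) (agrees o v).
Proof.
case: o => [u|]; last by left; left.
by apply: (iffP eqP) => [|[]]; first by right.
Qed.

Lemma agrees_Some u v : agrees (Some u) v = (u == v).
Proof. by []. Qed.

Lemma in_subcube n (w : word n q) (x : point n q) :
  reflect (forall i, agrees (w i) (x i)) (x \in subcube w).
Proof. by rewrite inE; apply: forallP. Qed.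

End Agreement.

(** Shows that subcubes are nonempty; the filler [b] for the stars is free, so that two fillers can
    be compared. *)
Lemma in_subcube_odflt n q (w : word n q) b :
  ([ffun i => odflt b (w i)] : point n q) \in subcube w.
Proof. by apply/in_subcube => i; rewrite ffunE; case: (w i) => //= c; apply/eqP. Qed.

(** Where [s] is fixed, every filling of the stars of [w] must give that value. A star of [w] there
    could be filled with both [ord0] and [ord_max], which differ as [1 < q]. *)
Lemma subcube_sub n q (w s : word n q) : 1 < q ->
  subcube w \subset subcube s -> forall i, s i = None \/ s i = w i.
Proof.
case: q w s => [|[|q]] // w s _ /subsetP sub i.
case Es: (s i) => [c|]; [right | by left].
have val_c b : odflt b (w i) = c.
  have /in_subcube/(_ i) := sub _ (in_subcube_odflt w b).
  by rewrite Es ffunE agrees_Some => /eqP.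
case: (w i) val_c => [d|] /= val_c; first by rewrite (val_c ord0).
by have := val_c ord_max; rewrite -(val_c ord0) => /(congr1 val).
Qed.

(** * Splitting off the first two coordinates *)

Section TwoHeads.
Variables (A : Type) (m : nat).

(** The type [A] is left open since both points and words are built this way. *)
Definition cons2 (a b : A) (t : 'I_m -> A) : {ffun 'I_m.+2 -> A} :=
  [ffun i => if unlift ord0 i is Some i' then
               if unlift ord0 i' is Some j then t j else b
             else a].

Definition fst2 : 'I_m.+2 := ord0.
Definition snd2 : 'I_m.+2 := lift ord0 (ord0 : 'I_m.+1).
Definition tail2 (j : 'I_m) : 'I_m.+2 := lift ord0 (lift ord0 j).

Lemma cons2_fst a b t : cons2 a b t fst2 = a.
Proof. by rewrite ffunE unlift_none. Qed.

Lemma cons2_snd a b t : cons2 a b t snd2 = b.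
Proof. by rewrite ffunE liftK unlift_none. Qed.

Lemma cons2_tail a b t j : cons2 a b t (tail2 j) = t j.
Proof. by rewrite ffunE !liftK. Qed.

Definition cons2E := (cons2_fst, cons2_snd, cons2_tail).

Lemma forall_ord2 (P : 'I_m.+2 -> Prop) :
  P fst2 -> P snd2 -> (forall j, P (tail2 j)) -> forall i, P i.
Proof.
move=> P0 P1 Pt i; case: (unliftP ord0 i) => [i'|] -> //.
by case: (unliftP ord0 i') => [j|] -> //; apply: Pt.
Qed.

End TwoHeads.

(** * Tail patterns, indexed by the first nonzero entry *)

Section Construction.
Variables (m r : nat).
Implicit Types (e : option ('I_m * 'I_r)) (y : 'I_m -> 'I_r.+1)
  (t : 'I_m -> option 'I_r.+1) (x : point m.+2 r.+1) (s : word m.+2 r.+1).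

(** [None] encodes the zero tail; [Some (k, d)] encodes the tails whose first nonzero entry is
    [d + 1], at position [k]. *)
Definition tail_word e (j : 'I_m) : option 'I_r.+1 :=
  if e is Some (k, d) then
    if j < k then Some ord0 else if j == k then Some (lift ord0 d) else None
  else Some ord0.

Definition agree_tail t y := forall j, agrees (t j) (y j).

Lemma tail_word_exists y : exists e, agree_tail (tail_word e) y.
Proof.
case: (pickP (fun j => y j != ord0)) => [j0 Hj0|y0]; last first.
  by exists None => j /=; rewrite agrees_Some eq_sym; apply: negbFE; apply: y0.
case: (@arg_minnP _ j0 (fun j => y j != ord0) (@nat_of_ord _) Hj0) => k yk kmin.
case: (unliftP ord0 (y k)) yk => [d|] Ed; last by rewrite Ed eqxx.
exists (Some (k, d)) => j /=; case: ltnP => [jk|_].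
  rewrite agrees_Some eq_sym; apply: contraTT jk => yj.
  by rewrite -leqNgt; apply: kmin.
by case: eqP => [->|//]; rewrite agrees_Some Ed.
Qed.

Lemma tail_word_pivot k d y :
  agree_tail (tail_word (Some (k, d))) y -> y k = lift ord0 d.
Proof. by move/(_ k); rewrite /= ltnn eqxx agrees_Some => /eqP. Qed.

Lemma tail_word_lt k d y (j : 'I_m) :
  agree_tail (tail_word (Some (k, d))) y -> j < k -> y j = ord0.
Proof. by move/(_ j) => /= yj jk; move: yj; rewrite jk agrees_Some => /eqP. Qed.

(** If the pivots differ, then at the smaller one the first pattern demands a nonzero value and the
    other demands zero. *)
Lemma tail_word_uniq e e' y :
  agree_tail (tail_word e) y -> agree_tail (tail_word e') y -> e = e'.
Proof.
have no_zero k d : agree_tail (tail_word (Some (k, d))) y ->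
    ~ agree_tail (tail_word None) y.
  by move=> /tail_word_pivot yk /(_ k) /eqP; rewrite yk.
case: e e' => [[k d]|] [[k' d']|] // H H'; last 2 first.
- by case: (no_zero _ _ H).
- by case: (no_zero _ _ H').
case: (ltngtP k k') => [kk'|k'k|/val_inj E].
- by have := tail_word_pivot H; rewrite (tail_word_lt H' kk').
- by have := tail_word_pivot H'; rewrite (tail_word_lt H k'k).
have := tail_word_pivot H; rewrite E (tail_word_pivot H') => /lift_inj -> //.
Qed.

(** Used with [t] the tail of a block-closed subcube that avoids the zero tail. The pattern of [y]
    has a pivot [k] and can differ from [t] only where [t] has a star; a star of [t] at or before
    [k] is impossible. *)
Lemma tail_word_closed t y :
    (forall z p, agree_tail t z -> agree_tail (tail_word (Some p)) z ->
       forall j, t j = None \/ t j = tail_word (Some p) j) ->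
    agree_tail t y -> ~ agree_tail t (fun=> ord0) ->
  exists p, agree_tail (tail_word (Some p)) y /\ t =1 tail_word (Some p).
Proof.
move=> closed ty t0; have [[[k d]|] ye] := tail_word_exists y; last first.
  by case: t0 => j; have /eqP[->] := ye j; apply: ty.
exists (k, d); split=> //; have le := closed _ _ ty ye.
have y_lt (j : 'I_m) : j < k -> y j = ord0 by apply: tail_word_lt ye.
(* Before [k] the entries of [t] are stars or zeros, after [k] they are stars; a star at [k] would
   let the zero tail in. *)
have tk : t k <> None.
  move=> tk; apply: t0 => j; apply/agreesP; have := le j.
  rewrite /=; case: ltnP => // _; case: eqP => [->|_]; first by left.
  by case; left.
move=> j; case: (le j) => // tj.
rewrite tj /=; case: ltnP => [jk|_]; last by case: eqP => // jk; rewrite -jk in tk.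
(* For a star of [t] at [j < k], a nonzero value put at [j] moves the pivot to [j]. The new pattern
   has a star at [k], so closedness makes [t k] a star, a contradiction. *)
pose z i := if i == j then lift ord0 d else y i.
case: tk; have := closed z (j, d) _ _ k; case=> // [i|i|].
- by rewrite /z; case: eqP => [->|_]; [rewrite tj | apply: ty].
- rewrite /z /=; case: ltnP => [ij|_].
    rewrite ifN ?y_lt ?(ltn_trans ij) // neq_ltn ij //.
  by case: eqP => // _; apply/eqP.
by rewrite /= ltnNge ltnW //= ifN // neq_ltn jk orbT.
Qed.

(* In [inl (b, c)] the head is (b+1, c+1). In [inr (e, a)], [e] is the tail pattern
   and [a] selects the piece of the L, the line being [a = 0]. *)
Definition key : finType :=
  (('I_r * 'I_r) + option ('I_m * 'I_r) * 'I_r.+1)%type.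

Definition block (k : key) : word m.+2 r.+1 :=
  match k with
  | inl (b, c) => cons2 (Some (lift ord0 b)) (Some (lift ord0 c)) (fun=> None)
  | inr (None, a) =>
      if a == ord0 then cons2 (Some ord0) None (tail_word None)
      else cons2 (Some a) (Some ord0) (tail_word None)
  | inr (Some p, a) =>
      if a == ord0 then cons2 None (Some ord0) (tail_word (Some p))
      else cons2 (Some ord0) (Some a) (tail_word (Some p))
  end.

(** * Each point lies in exactly one block *)

Lemma in_cons2 a c t x :
  x \in subcube (cons2 a c t) <->
  [/\ agrees a (x (fst2 m)), agrees c (x (snd2 m)) &
      agree_tail t (fun j => x (tail2 j))].
Proof.
split=> [/in_subcube xw|[xa xc xt]].
  split=> [||j]; first by have := xw (fst2 m); rewrite cons2E.
    by have := xw (snd2 m); rewrite cons2E.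
  by have := xw (tail2 j); rewrite cons2E.
by apply/in_subcube; apply: forall_ord2 => [||j]; rewrite cons2E.
Qed.

Lemma block_exists x : exists k, x \in subcube (block k).
Proof.
case: (unliftP ord0 (x (fst2 m))) => [b|] Eb.
  case: (unliftP ord0 (x (snd2 m))) => [c|] Ec.
    by exists (inl (b, c)); apply/in_cons2; rewrite Eb Ec !agrees_Some.
  have [[p|] te] := tail_word_exists (fun j => x (tail2 j)).
    by exists (inr (Some p, ord0)); apply/in_cons2; rewrite Ec.
  by exists (inr (None, lift ord0 b)); apply/in_cons2; rewrite Eb Ec !agrees_Some.
have [[p|] te] := tail_word_exists (fun j => x (tail2 j)).
  exists (inr (Some p, x (snd2 m))) => /=; case: eqP => [E|_].
    by apply/in_cons2; rewrite E.
  by apply/in_cons2; rewrite Eb !agrees_Some.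
by exists (inr (None, ord0)); apply/in_cons2; rewrite Eb.
Qed.

(** The key can be read off from the point: two nonzero head entries give the [inl] key; otherwise
    the tail gives [e], and [a] is the first head entry for the zero tail and the second one for the
    other tails. *)
Lemma block_uniq k k' x :
  x \in subcube (block k) -> x \in subcube (block k') -> k = k'.
Proof.
have inrE e a : x \in subcube (block (inr (e, a))) ->
  agree_tail (tail_word e) (fun j => x (tail2 j)) /\
  a = (if e is None then x (fst2 m) else x (snd2 m)) /\
  (x (fst2 m) = ord0 \/ x (snd2 m) = ord0).
  case: e => [p|] /=; case: eqP => [->|_] /in_cons2 [];
    rewrite ?agrees_Some => /eqP Ea /eqP Ec te; do ?split=> //; auto.
have inlE b c : x \in subcube (block (inl (b, c))) ->
    x (fst2 m) = lift ord0 b /\ x (snd2 m) = lift ord0 c.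
  by case/in_cons2; rewrite !agrees_Some => /eqP-> /eqP->.
case: k k' => [[b c]|[e a]] [[b' c']|[e' a']].
- by move=> /inlE[E1 E2] /inlE[]; rewrite E1 E2 => /lift_inj-> /lift_inj->.
- by move=> /inlE[E1 E2] /inrE[_ [_]]; rewrite E1 E2; case.
- by move=> /inrE[te [Ea H]] /inlE[E1 E2]; rewrite E1 E2 in H; case: H.
move=> /inrE[te [Ea _]] /inrE[te' [Ea' _]].
by move: Ea Ea'; rewrite (tail_word_uniq te te') => -> ->.
Qed.

Lemma block_inj : injective block.
Proof.
move=> k k' E; have := in_subcube_odflt (block k) ord0 => H.
by apply: (block_uniq H); rewrite -E.
Qed.

(** * Size, partition property and tightness *)

Definition blocks : {set word m.+2 r.+1} := [set block k | k : key].

Lemma blocks_uniq w w' x : w \in blocks -> w' \in blocks ->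
  x \in subcube w -> x \in subcube w' -> w = w'.
Proof.
by case/imsetP=> k _ -> /imsetP[k' _ ->] xk xk'; rewrite (block_uniq xk xk').
Qed.

Lemma card_blocks : #|blocks| = m.+1 * r.+1 * r + 1.
Proof.
rewrite card_imset; last exact: block_inj.
rewrite card_sum !card_prod card_option card_prod !card_ord; lia.
Qed.

Lemma blocks_partition : subcube_partition blocks.
Proof.
apply/and3P; split.
- apply/eqP/setP => x; rewrite inE; have [k xk] := block_exists x.
  apply/bigcupP; exists (subcube (block k)) => //.
  by apply: imset_f; apply: imset_f.
- apply/trivIsetP => _ _ /imsetP[_ /imsetP[k _ ->] ->] /imsetP[_ /imsetP[k' _ ->] ->].
  apply: contraR => /pred0Pn[x /andP[xk xk']].
  by rewrite (block_uniq xk xk').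
- apply/imsetP => -[w _ E].
  by have := in_subcube_odflt w ord0; rewrite -E inE.
Qed.

Lemma blocks_tight : 0 < r -> tight blocks.
Proof.
(* The block of [inr (None, ord0)] has a star only at the second coordinate; that one is fixed by a
   piece with nonzero [a], here [ord_max]. *)
move=> r0; have rmax : (@ord_max r == ord0) = false.
  by apply/eqP => /(congr1 val) /= E; rewrite E in r0.
apply: forall_ord2 => [||j].
- exists (block (inr (None, ord0))); first exact: imset_f.
  by rewrite /= cons2E.
- exists (block (inr (None, ord_max))); first exact: imset_f.
  by rewrite /= rmax cons2E.
- exists (block (inr (None, ord0))); first exact: imset_f.
  by rewrite /= cons2E.
Qed.

(** * Block-closed subcubes and irreducibility *)

Lemma tail_word_exists_Some y j :
  y j != ord0 -> exists p, agree_tail (tail_word (Some p)) y.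
Proof.
have [[p|] yp] := tail_word_exists y; first by exists p.
by have /eqP[<-] := yp j; rewrite eqxx.
Qed.

(** What is kept of a union of blocks: a block that meets [s] lies in [s], written on words as in
    [subcube_sub]. *)
Definition block_closed s := forall x w,
  x \in subcube s -> w \in blocks -> x \in subcube w ->
  forall i, s i = None \/ s i = w i.

(** The cases are: first entry fixed to zero; second entry fixed to zero; neither. In each,
    well-chosen blocks that meet [s] force its entries one by one. *)
Lemma block_closedP s :
  0 < m -> 0 < r -> block_closed s -> s \in blocks \/ s = [ffun=> None].
Proof.
move=> m0 r0 closed.
have nz_max : @ord_max r != ord0 by rewrite -val_eqE -lt0n.
set s1 := s (fst2 m); set s2 := s (snd2 m); set t := fun j => s (tail2 j).
have s_eq ka kc kt : s1 = ka -> s2 = kc -> t =1 kt -> s = cons2 ka kc kt.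
  move=> E1 E2 Et; apply/ffunP; apply: forall_ord2 => [||j]; rewrite cons2E //.
  exact: Et.
have cl a c y ka kc kt : agrees s1 a -> agrees s2 c -> agree_tail t y ->
    cons2 ka kc kt \in blocks ->
    agrees ka a -> agrees kc c -> agree_tail kt y ->
    [/\ s1 = None \/ s1 = ka, s2 = None \/ s2 = kc &
        forall j, t j = None \/ t j = kt j].
  (* The point [(a, c | y)] is the common point of [s] and the block to which closedness is
     applied. *)
  move=> s1a s2c ty wB kaa kcc kty.
  have xs : cons2 a c y \in subcube s.
    rewrite (s_eq _ _ _ erefl erefl (frefl _)); apply/in_cons2.
    by rewrite !cons2E; split=> // j; rewrite cons2E.
  have xw : cons2 a c y \in subcube (cons2 ka kc kt).
    by apply/in_cons2; rewrite !cons2E; split=> // j; rewrite cons2E.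
  have H := closed _ _ xs wB xw.
  split=> [||j]; first by have := H (fst2 m); rewrite cons2E.
    by have := H (snd2 m); rewrite cons2E.
  by have := H (tail2 j); rewrite cons2E.
have B1 a c : a != ord0 -> c != ord0 ->
    cons2 (Some a) (Some c) (fun=> None) \in blocks.
  case: (unliftP ord0 a) => [b ->|->]; last by rewrite eqxx.
  case: (unliftP ord0 c) => [d ->|->]; last by rewrite eqxx.
  by move=> _ _; apply/imsetP; exists (inl (b, d)).
have B2 : cons2 (Some ord0) None (tail_word None) \in blocks.
  by apply/imsetP; exists (inr (None, ord0)).
have B3 a : a != ord0 -> cons2 (Some a) (Some ord0) (tail_word None) \in blocks.
  by move=> /negPf Ea; apply/imsetP; exists (inr (None, a)); rewrite //= Ea.
have B4 p : cons2 None (Some ord0) (tail_word (Some p)) \in blocks.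
  by apply/imsetP; exists (inr (Some p, ord0)).
have B5 p c : c != ord0 ->
    cons2 (Some ord0) (Some c) (tail_word (Some p)) \in blocks.
  by move=> /negPf Ec; apply/imsetP; exists (inr (Some p, c)); rewrite //= Ec.
have nz o : o <> Some ord0 -> exists2 a : 'I_r.+1, a != ord0 & agrees o a.
  case: o => [a|] Ho; last by exists ord_max.
  by exists a; [apply/eqP => E; rewrite E in Ho | rewrite agrees_Some].
have agree0 (o : option 'I_r.+1) : agrees o (odflt ord0 o).
  by case: o => //= u; apply/eqP.
(* Filling stars with zero makes [y0] a sample tail that vanishes only if [t] admits the zero
   tail. *)
pose y0 j := odflt ord0 (t j); have ty0 : agree_tail t y0 by move=> j; apply: agree0.
have ty0_nz : ~ agree_tail t (fun=> ord0) ->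
    exists p, agree_tail (tail_word (Some p)) y0.
  move=> t0; have [j yj] : exists j, y0 j != ord0.
    apply/existsP; apply: contra_notT t0; rewrite negb_exists => /forallP yz j.
    by have := yz j; rewrite negbK => /eqP <-.
  exact: tail_word_exists_Some yj.
have star_nz j : agree_tail t (fun=> ord0) -> t j = None ->
    exists2 y, agree_tail t y & exists p, agree_tail (tail_word (Some p)) y.
  move=> t0 tj; exists (fun i => if i == j then ord_max else ord0).
    by move=> i; case: eqP => [->|_]; [rewrite tj | apply: t0].
  by apply: (@tail_word_exists_Some _ j); rewrite eqxx.
have T0 : agree_tail (tail_word None) (fun=> ord0) by move=> j; apply: eqxx.
have agree1 (a : 'I_r.+1) : agrees (Some a) a by apply: eqxx.
have [s1z|/eqP/nz[a a0 s1a]] := eqVneq s1 (Some ord0).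
  have s10 : agrees s1 ord0 by rewrite s1z.
  (* A full line [c = 0] over a nonzero tail would meet [s] and force a star at the first entry,
     which is fixed to zero. *)
  have no_star y p : agrees s2 ord0 -> agree_tail t y ->
      agree_tail (tail_word (Some p)) y -> False.
    move=> s20 ty yp.
    by have [[] E1 _ _] := cl _ _ _ _ _ _ s10 s20 ty (B4 p) isT (agree1 _) yp;
      rewrite E1 in s1z.
  case: (boolP [forall j, agrees (t j) ord0]) => [/forallP t0|/forallP t0].
    (* The full line [a = 0] over the zero tail meets [s], so the second entry is a star; a star in
       the tail would then contradict [no_star]. Hence [s] is this line. *)
    have [_ E2 Et] := cl _ _ _ _ _ _ s10 (agree0 s2) t0 B2 (agree1 _) isT T0.
    have {}E2 : s2 = None by case: E2.
    left; rewrite (s_eq _ _ (tail_word None) s1z E2) // => j; case: (Et j) => // tj.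
    have [y ty [p yp]] := star_nz j t0 tj.
    by case: (no_star _ _ _ ty yp); rewrite E2.
  (* With the zero tail excluded, [no_star] fixes the second entry to a nonzero [c], and [s] is a
     single-point piece over one tail pattern. *)
  have [p0 y0p] := ty0_nz t0.
  have [c s2c] : exists c, s2 = Some c.
    case E: s2 => [c|]; first by exists c.
    by case: (no_star _ _ _ ty0 y0p); rewrite E.
  have c0 : c != ord0.
    by apply/eqP => E; case: (no_star _ _ _ ty0 y0p); rewrite s2c E.
  have [z q tz zq|p [_ Et]] := tail_word_closed _ ty0 t0.
    have s2a : agrees s2 c by rewrite s2c.
    by have [] := cl _ _ _ _ _ _ s10 s2a tz (B5 q c c0) (agree1 _) (agree1 _) zq.
  by left; rewrite (s_eq _ _ _ s1z s2c Et); apply: B5.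
have [s2z|/eqP/nz[c c0 s2c]] := eqVneq s2 (Some ord0).
  have s20 : agrees s2 ord0 by rewrite s2z.
  have star1 y p : agree_tail t y -> agree_tail (tail_word (Some p)) y ->
      s1 = None.
    move=> ty yp.
    by have [[]] := cl _ _ _ _ _ _ s1a s20 ty (B4 p) isT (agree1 _) yp.
  case: (boolP [forall j, agrees (t j) ord0]) => [/forallP t0|/forallP t0].
    have [E1 _ Et] := cl _ _ _ _ _ _ s1a s20 t0 (B3 a a0) (agree1 _) (agree1 _) T0.
    (* With a star at the first entry, [s] would meet the line [a = 0] over the zero tail, and its
       second entry would be a star instead of zero. *)
    have s1_star : s1 <> None.
      move=> E; have s10 : agrees s1 ord0 by rewrite E.
      have [_ E2 _] := cl _ _ _ _ _ _ s10 s20 t0 B2 (agree1 _) isT T0.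
      by case: E2 => E2; rewrite E2 in s2z.
    have {}E1 : s1 = Some a by case: E1.
    left; rewrite (s_eq _ _ (tail_word None) E1 s2z) => [|j]; first exact: B3.
     case: (Et j) => // tj; have [y ty [p yp]] := star_nz j t0 tj.
    by case: s1_star; apply: star1 ty yp.
  (* Only nonzero tails remain, so [s] is a full line [c = 0] over one pattern. *)
  have [p0 y0p] := ty0_nz t0; have s1_star := star1 _ _ ty0 y0p.
  have [z q tz zq|p [_ Et]] := tail_word_closed _ ty0 t0.
    by have [] := cl _ _ _ _ _ _ s1a s20 tz (B4 q) isT (agree1 _) zq.
  by left; rewrite (s_eq _ _ _ s1_star s2z Et); apply: B4.
(* Here [s] meets a block with nonzero head, so its tail is all stars. Each splitting of the L then
   carries a star from one head entry to the other. *)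
have [E1 E2 Et] := cl _ _ _ _ _ _ s1a s2c ty0 (B1 _ _ a0 c0) (agree1 _) (agree1 _)
  (fun=> isT).
have {}Et j : t j = None by case: (Et j).
have ty y : agree_tail t y by move=> j; rewrite Et.
have s2_star : s1 = None -> s2 = None.
  move=> E; have s10 : agrees s1 ord0 by rewrite E.
  by have [_ []] := cl _ _ _ _ _ _ s10 s2c (ty _) B2 (agree1 _) isT T0.
have s1_star : s2 = None -> s1 = None.
  move=> E; have s20 : agrees s2 ord0 by rewrite E.
  (* A nonzero tail exists because [m] and [r] are positive. *)
  have [p yp] := @tail_word_exists_Some (fun=> ord_max) (Ordinal m0) nz_max.
  by have [[]] := cl _ _ _ _ _ _ s1a s20 (ty _) (B4 p) isT (agree1 _) yp.
have star : s1 = None -> s2 = None -> s = [ffun=> None].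
  by move=> F1 F2; apply/ffunP; apply: forall_ord2 => [||j];
    rewrite ffunE; [exact: F1 | exact: F2 | exact: Et].
case: E1 => E1; first by right; apply: star => //; apply: s2_star.
case: E2 => E2; first by right; apply: star => //; apply: s1_star.
by left; rewrite (s_eq _ _ _ E1 E2 Et); apply: B1.
Qed.

(** By disjointness every block that meets the union [s] of [G] belongs to [G], so [s] is
    block-closed. If [s] is a block then [G] has at most one element; if [s] is the whole cube then
    [G] contains all blocks. *)
Lemma blocks_irreducible : 0 < m -> 0 < r -> irreducible_family blocks.
Proof.
move=> m0 r0 [G [/subsetP GB /andP[G1 GF] [s Us]]].
have inG x w : x \in subcube s -> w \in blocks -> x \in subcube w -> w \in G.
  rewrite -Us => /bigcupP[w' w'G xw'] wB xw.
  by rewrite (blocks_uniq wB (GB _ w'G) xw xw').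
have closed : block_closed s.
  move=> x w xs wB xw; apply: subcube_sub => //.
  by rewrite -Us; apply: bigcup_sup; apply: inG xw.
case: (block_closedP m0 r0 closed) => [sB|s_star].
  have : G \subset [set s].
    apply/subsetP => w wG; rewrite inE; apply/eqP.
    have xw := in_subcube_odflt w ord0.
    have xs : ([ffun i => odflt ord0 (w i)] : point _ _) \in subcube s.
      by rewrite -Us; apply/bigcupP; exists w.
    exact: blocks_uniq (GB _ wG) sB xw xs.
  by move/subset_leq_card; rewrite cards1 leqNgt G1.
have : blocks \subset G.
  apply/subsetP => w wB; apply: inG (wB) (in_subcube_odflt w ord0).
  by apply/in_subcube => i; rewrite s_star ffunE.
by move/subset_leq_card; rewrite leqNgt GF.
Qed.

End Construction.

Theorem theorem3p4 (n q : nat) (hn : 3 <= n) (hq : 2 <= q) :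
  exists F : {set word n q},
    [/\ subcube_partition F, tight F, irreducible_family F &
        #|F| = (n - 1) * q * (q - 1) + 1].
Proof.
(* With [n = m + 2] and [q = r + 1] the hypotheses become [0 < m] and [0 < r]. *)
case: n hn => [|[|m]] // hm; case: q hq => [|r] // hr; exists (blocks m r); split.
- exact: blocks_partition.
- exact: blocks_tight.
- exact: blocks_irreducible.
- by rewrite card_blocks !subSS !subn0.
Qed.
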